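(* Let $N=J_{n_1}\oplus\cdots\oplus J_{n_k}\in \mathbb{M}_{n\times n}$ be a nilpotent matrix, where $n_1+\cdots+n_k=n$. The group $\mathrm{Col}(N)$ is a proper subgroup of $\bigl(\mathrm{Alg}\,\mathrm{Lat}\,(N)'\bigr)^{-1}$ if and only if at least two of the Jordan blocks $J_{n_1},\ldots,J_{n_k}$ are of dimension $2$ or more.
   Context: $\mathbb{M}_{n\times n}$ is the algebra of complex $n\times n$ matrices, acting as linear transformations on $\mathbb{C}^n$. $J_m$ is the $m\times m$ nilpotent upper-triangular Jordan block, i.e. $J_m e_1=0$ and $J_m e_j=e_{j-1}$ for $2\le j\le m$; $J_1=0$. For a linear transformation $A$ on a finite-dimensional complex vector space $V$: $\mathrm{Lat}(A)$ is the lattice of all subspaces $M\subseteq V$ with $AM\subseteq M$; $\mathrm{Col}(A)$ is the group of all invertible linear transformations $S$ on $V$ such that for every subspace $M$ of $V$ one has $M\in\mathrm{Lat}(A)\iff SM\in\mathrm{Lat}(A)$. $(A)'=\{T:\ TA=AT\}$ is the commutant of $A$, $\mathrm{Lat}\,(A)'$ is the set of all subspaces of $V$ invariant under every element of $(A)'$ (hyperinvariant subspaces of $A$), and $\mathrm{Alg}\,\mathrm{Lat}\,(A)'$ is the algebra of all linear transformations $T$ on $V$ with $TM\subseteq M$ for every $M\in\mathrm{Lat}\,(A)'$. For a unital algebra $\mathcal{A}$ of linear transformations, $\mathcal{A}^{-1}$ is the group of invertible elements of $\mathcal{A}$. *)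

(* Defs.v *)
From HB Require Import structures.
From mathcomp Require Import all_boot all_order all_algebra.
From mathcomp Require Import complex.
From mathcomp Require Import boolp classical_sets reals.

Set Implicit Arguments.
Unset Strict Implicit.
Unset Printing Implicit Defensive.

Import GRing.Theory.

Local Open Scope classical_set_scope.
Local Open Scope ring_scope.

Section LinearTransformations.
Variables (F : fieldType) (V : vectType F).
Implicit Types (A S T : 'End(V)) (M : {vspace V}).

Definition Lat A : set {vspace V} := [set M | (A @: M <= M)%VS].

Definition LatOf (X : set 'End(V)) : set {vspace V} :=
  [set M | forall T, X T -> Lat T M].

Definition AlgOf (L : set {vspace V}) : set 'End(V) :=
  [set T | forall M, L M -> Lat T M].

Definition commutant A : set 'End(V) := [set T | (T \o A)%VF = (A \o T)%VF].

(* The inverse is required to lie in X as well. *)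
Definition invertibles (X : set 'End(V)) : set 'End(V) :=
  [set S | X S /\ exists T, [/\ X T, (S \o T = \1)%VF & (T \o S = \1)%VF]].

Definition Col A : set 'End(V) :=
  [set S | invertibles setT S /\ forall M, Lat A M <-> Lat A (S @: M)%VS].

(* H and G are sets of invertible transformations, with composition as the
   group law. *)
Definition subgroup (H G : set 'End(V)) : Prop :=
  [/\ H `<=` G,
      H \1%VF,
      forall S T, H S -> H T -> H (S \o T)%VF
    & forall S, H S -> H (S^-1)%VF].

Definition proper_subgroup (H G : set 'End(V)) : Prop :=
  subgroup H G /\ H <> G.

End LinearTransformations.

(* With 0-based indices and matrices acting on columns, the 1 in position
   (j - 1, j) says J e_j = e_(j-1). *)
Definition jordan_block (K : nzRingType) (m : nat) : 'M[K]_m :=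
  \matrix_(i < m, j < m) (i.+1 == j)%:R.

Definition jordan_nilpotent (K : fieldType) (k : nat) (m : 'I_k -> nat) :
    'End('cV[K]_(\sum_(i < k) m i)) :=
  linfun (mulmx (\mxdiag_(i < k) jordan_block K (m i))).

(* Main.v *)
(* Let g_1, ..., g_k be cyclic generators of the Jordan blocks, so that the
   nonzero vectors N^j g_i form a basis.

   A collineation S preserves dimensions, and ker N^a is the union of the
   invariant subspaces of dimension at most a, while the range of N^b is the
   intersection of those of codimension at most b; hence S preserves all these
   kernels and ranges. A hyperinvariant M is spanned by the N^j g_i it contains,
   and with N^j g_i it contains the intersection of ker N^(n_i - j) and the
   range of N^j, because every vector there is T (N^j g_i) for some T commuting
   with N. So S M is contained in M.

   If only one block has size at least 2, each T in (N)' satisfies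
   T N = q(N) N for some polynomial q. Then for M in Lat(N) both N M and
   N^-1(N M) are hyperinvariant; an invertible S in Alg Lat (N)' fixes them,
   and N M <= M <= N^-1(N M) gives S M in Lat(N).

   If blocks a <> b have size at least 2, take x in their sum with N^2 x = 0 and
   N x the sum of the last basis vectors of both blocks. Doubling the last basis
   vector of block a and fixing all the others belongs to Alg Lat (N)' but
   destroys the invariance of span(x, N x). *)
From HB Require Import structures.
Require Import Defs.
From mathcomp Require Import all_boot all_order all_algebra.
From mathcomp Require Import complex.
From mathcomp Require Import boolp classical_sets reals.
From mathcomp Require Import zify.

Set Implicit Arguments.
Unset Strict Implicit.
Unset Printing Implicit Defensive.

Import GRing.Theory.

Local Open Scope classical_set_scope.
Local Open Scope ring_scope.

(** * Iterates, invariant subspaces and collineations of an endomorphism *)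

Section Endomorphisms.
Variables (K : fieldType) (V : vectType K).
Implicit Types (A B S T N : 'End(V)) (M : {vspace V}).

Definition iter_lfun A n : 'End(V) := iter n (comp_lfun A) \1%VF.

Lemma iter_lfun0 A v : iter_lfun A 0 v = v.
Proof. exact: id_lfunE. Qed.

Lemma iter_lfunS A n v : iter_lfun A n.+1 v = A (iter_lfun A n v).
Proof. exact: comp_lfunE. Qed.

Lemma iter_lfunD A n p v :
  iter_lfun A (n + p) v = iter_lfun A n (iter_lfun A p v).
Proof.
by elim: n => [|n IHn]; rewrite ?iter_lfun0 // addSn !iter_lfunS IHn.
Qed.

Lemma iter_lfunSr A n v : iter_lfun A n.+1 v = iter_lfun A n (A v).
Proof. by rewrite -addn1 iter_lfunD iter_lfunS iter_lfun0. Qed.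

Lemma LatP A M : Lat A M <-> {in M, forall v, A v \in M}.
Proof.
split=> [/subvP AM v Mv | AM]; first exact/AM/memv_img.
by apply/subvP => _ /memv_imgP[v Mv ->]; apply: AM.
Qed.

Lemma Lat_iter A M n v : Lat A M -> v \in M -> iter_lfun A n v \in M.
Proof.
move=> /LatP AM Mv; elim: n => [|n IHn]; first by rewrite iter_lfun0.
by rewrite iter_lfunS AM.
Qed.

Lemma commutantP A T : commutant A T <-> forall v, T (A v) = A (T v).
Proof.
split=> [TA v|TA]; first by rewrite -!comp_lfunE TA.
by apply/lfunP => v; rewrite !comp_lfunE TA.
Qed.

Lemma commutant_iter A T n v : commutant A T ->
  T (iter_lfun A n v) = iter_lfun A n (T v).
Proof.
move=> /commutantP TA; elim: n => [|n IHn]; first by rewrite !iter_lfun0.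
by rewrite !iter_lfunS TA IHn.
Qed.

Lemma Lat_limg A M : Lat A M -> Lat A (A @: M)%VS.
Proof. exact: limgS. Qed.

Lemma Lat_lpreim A M : Lat A M -> Lat A (A @^-1: M)%VS.
Proof. by move=> /LatP AM; apply/LatP => v; rewrite -!memv_preim => /AM. Qed.

(** Applying [N] lowers the dimension of an invariant subspace unless [N M = M], and then
    [M = N^n M = 0]. *)
Lemma iter_lfun_dim0 N n M a : (forall v, iter_lfun N n v = 0) ->
  Lat N M -> (\dim M <= a)%N -> {in M, forall v, iter_lfun N a v = 0}.
Proof.
move=> N0; elim: a M => [|a IHa] M NM.
  rewrite leqn0 dimv_eq0 => /eqP-> v; rewrite memv0 => /eqP->.
  by rewrite linear0.
move=> dimM v Mv; have [NMM|NMM] := eqVneq (N @: M)%VS M.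
  suff M_iter p : M = (iter_lfun N p @: M)%VS.
    have : v \in (iter_lfun N n @: M)%VS by rewrite -M_iter.
    by case/memv_imgP=> u _ ->; rewrite N0 linear0.
  elim: p => [|p IHp]; first by rewrite lim1g.
  by rewrite -{1}NMM {1}IHp -limg_comp.
rewrite iter_lfunSr; apply: (IHa (N @: M)%VS); last exact: memv_img.
  exact: Lat_limg.
have := NMM; rewrite eqEdim (NM : (N @: M <= M)%VS) /= -ltnNge => ltNM.
by rewrite -ltnS (leq_trans ltNM).
Qed.

(** Dually, taking the preimage under [N] lowers the codimension unless [M] is its own preimage, and
    then [N^n = 0] puts every vector in [M]. *)
Lemma iter_lfun_codim N n M b : (forall v, iter_lfun N n v = 0) ->
  Lat N M -> (\dim {:V} <= \dim M + b)%N -> forall v, iter_lfun N b v \in M.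
Proof.
move=> N0; elim: b M => [|b IHb] M NM dimM v.
  suff -> : M = fullv by rewrite memvf.
  by apply/eqP; rewrite eqEdim subvf -[X in (_ <= X)%N]addn0.
have NMM : (M <= N @^-1: M)%VS.
  by apply/subvP => u Mu; rewrite -memv_preim (LatP N M).1.
have [MN|MN] := eqVneq M (N @^-1: M)%VS.
  suff M_iter p u : (u \in M) = (iter_lfun N p u \in M).
    by rewrite (M_iter n) N0 mem0v.
  elim: p u => [|p IHp] u; first by rewrite iter_lfun0.
  by rewrite iter_lfunSr -IHp {1}MN -memv_preim.
rewrite iter_lfunS memv_preim; apply: IHb; first exact: Lat_lpreim.
rewrite (leq_trans dimM) // addnS -addSn leq_add2r ltnNge.
by apply: contra MN => dimN; rewrite eqEdim NMM.
Qed.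

Lemma invertibles_lker0 S : invertibles setT S <-> lker S == 0%VS.
Proof.
split=> [[_ [T [_ _ TS]]]|S0].
  by apply/lker0P/(can_inj (g := T)) => v; rewrite -comp_lfunE TS id_lfunE.
split=> //; exists (S^-1)%VF; split=> //.
  exact: lker0_compfV.
exact: lker0_compVf.
Qed.

Lemma Col_inv N S : Col N S -> Col N (S^-1)%VF.
Proof.
move=> [/invertibles_lker0 S0 NS]; have SV := lker0_compfV S0.
split.
  split=> //; exists S; split=> //; exact: lker0_compVf.
by move=> M; rewrite (NS (S^-1 @: M)%VS) -limg_comp SV lim1g.
Qed.

Lemma Col_comp N S T : Col N S -> Col N T -> Col N (S \o T)%VF.
Proof.
move=> [/invertibles_lker0/lker0P S0 NS] [/invertibles_lker0/lker0P T0 NT].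
split; last by move=> M; rewrite limg_comp (NT M) (NS (T @: M)%VS).
apply/invertibles_lker0/lker0P => u v.
by rewrite !comp_lfunE => /S0/T0.
Qed.

Lemma Col_id N : Col N \1%VF.
Proof.
split; last by move=> M; rewrite lim1g.
by split=> //; exists \1%VF; split=> //; rewrite comp_lfun1l.
Qed.

(* For nilpotent [N], the kernel of [N ^ a] is the union of the invariant
   subspaces of dimension at most [a]. *)
Lemma Col_iter_ker N n S a v : (forall u, iter_lfun N n u = 0) ->
  Col N S -> iter_lfun N a v = 0 -> iter_lfun N a (S v) = 0.
Proof.
move=> N0 [_ NS] Nv.
(* The cyclic subspace generated by [v]: since [N^a v = 0], these [a] vectors span it. *)
pose s := [seq iter_lfun N j v | j <- iota 0 a].
have mem_s j : iter_lfun N j v \in <<s>>%VS.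
  have [ja|aj] := ltnP j a.
    by apply: memv_span; apply: map_f; rewrite mem_iota.
  by rewrite -(subnK aj) iter_lfunD Nv linear0 mem0v.
have Ns : Lat N <<s>>%VS.
  rewrite /Lat /= limg_span; apply/span_subvP => _ /mapP[_ /mapP[j _ ->] ->].
  by rewrite -iter_lfunS.
apply: (iter_lfun_dim0 N0 ((NS _).1 Ns)).
  rewrite (leq_trans _ (_ : \dim <<s>> <= a)%N) //.
    by rewrite -(limg_ker_dim S <<s>>) leq_addl.
  by rewrite (leq_trans (dim_span s)) // size_map size_iota.
by apply: memv_img; have := mem_s 0; rewrite iter_lfun0.
Qed.

End Endomorphisms.

(** * Rank-one endomorphisms, from which maps given by coordinates are built *)

Section RankOne.
Variables (K : fieldType) (V : vectType K).

Definition rank1_fun (f : 'Hom(V, K^o)) (z v : V) : V := (f v : K) *: z.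

Fact rank1_fun_is_linear f z : linear (rank1_fun f z).
Proof. by move=> a u v; rewrite /rank1_fun linearP scalerDl scalerA. Qed.

HB.instance Definition _ f z :=
  GRing.isLinear.Build K V V *:%R (rank1_fun f z) (rank1_fun_is_linear f z).

Definition rank1 f z : 'End(V) := linfun (rank1_fun f z).

Lemma rank1E f z v : rank1 f z v = (f v : K) *: z.
Proof. by rewrite lfunE. Qed.

End RankOne.

(** * Collineations and hyperinvariant subspaces in a Jordan basis *)

Section JordanBasis.
Variables (K : fieldType) (V : vectType K) (N : 'End(V)).
Variables (k : nat) (m : 'I_k -> nat).
(** Each chain [g i] is continued by zeros from [m i] on, so that [N] is a plain shift of the index;
    [c] is the dual family of coordinates. *)
Variables (g : 'I_k -> nat -> V) (c : 'I_k -> nat -> 'Hom(V, K^o)).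

Hypothesis g_shift : forall i j, N (g i j) = g i j.+1.
Hypothesis g_end : forall i j, (m i <= j)%N -> g i j = 0.
Hypothesis c_g : forall i j i' j',
  c i j (g i' j') = [&& i == i', j == j' & (j < m i)%N]%:R.
Hypothesis g_gen : forall v, v = \sum_i \sum_(j < m i) c i j v *: g i j.

Implicit Types (S T : 'End(V)) (M : {vspace V}).

Let eqV_g S T : (forall i j, (j < m i)%N -> S (g i j) = T (g i j)) -> S = T.
Proof.
move=> eqST; apply/lfunP => v; rewrite (g_gen v) !linear_sum.
apply: eq_bigr => i _; rewrite !linear_sum; apply: eq_bigr => j _.
by rewrite !linearZ /= eqST.
Qed.

Lemma iter_lfun_g n i j : iter_lfun N n (g i j) = g i (n + j).
Proof.
by elim: n => [|n IHn]; rewrite ?iter_lfun0 // iter_lfunS IHn g_shift.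
Qed.

Lemma c_end i j v : (m i <= j)%N -> c i j v = 0.
Proof.
move=> mj; rewrite (g_gen v) linear_sum big1 // => i' _.
rewrite linear_sum big1 // => j' _; rewrite linearZ /= c_g.
by rewrite [(j < _)%N]ltnNge mj !andbF scaler0.
Qed.

Lemma c_shiftS i j v : (j.+1 < m i)%N -> c i j.+1 (N v) = c i j v.
Proof.
move=> mj; rewrite {1}(g_gen v) [in RHS](g_gen v) !linear_sum.
apply: eq_bigr => i' _; rewrite !linear_sum; apply: eq_bigr => j' _.
by rewrite !linearZ /= g_shift !c_g eqSS mj (ltnW mj).
Qed.

Lemma c_shift0 i v : c i 0 (N v) = 0.
Proof.
rewrite (g_gen v) !linear_sum big1 // => i' _.
rewrite !linear_sum big1 // => j' _.
by rewrite !linearZ /= g_shift c_g andbF scaler0.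
Qed.

Lemma nilpotent_N v : iter_lfun N (\sum_i m i) v = 0.
Proof.
rewrite (g_gen v) linear_sum big1 // => i _; rewrite linear_sum big1 // => j _.
rewrite linearZ /= iter_lfun_g g_end ?scaler0 //.
by rewrite (bigD1 i) //= -addnA leq_addr.
Qed.

Lemma iter_lfun_imgP b v :
  (forall i j, (j < b)%N -> c i j v = 0) -> exists z, v = iter_lfun N b z.
Proof.
move=> v0; exists (\sum_i \sum_(j < m i | (b <= j)%N) c i j v *: g i (j - b)).
rewrite {1}(g_gen v) linear_sum; apply: eq_bigr => i _; rewrite linear_sum.
rewrite [RHS]big_mkcond; apply: eq_bigr => j _.
case: leqP => [bj|jb]; last by rewrite v0 // scale0r.
by rewrite linearZ /= iter_lfun_g subnKC.
Qed.

(* For [j < m i], the vectors whose coordinates [c i 0, ..., c i j] vanish form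
   an invariant subspace of codimension at most [j.+1]; the range of [N ^ b] is
   the intersection of those with [j < b]. *)
Lemma Col_iter_img S b z : Col N S ->
  exists y, S (iter_lfun N b z) = iter_lfun N b y.
Proof.
move=> CS; apply: iter_lfun_imgP => i j jb.
have [/invertibles_lker0 S0 NS] := CS; have [_ NSV] := Col_inv CS.
have [mj|mj] := ltnP j (m i); last by rewrite c_end.
(* [P] keeps the first [j.+1] coordinates of block [i], so its kernel is the invariant subspace
   announced above. *)
pose P := (\sum_(l < j.+1) rank1 (c i l) (g i l))%R.
have PE v : P v = \sum_(l < j.+1) (c i l v : K) *: g i l.
  by rewrite sum_lfunE; apply: eq_bigr => l _; rewrite rank1E.
have kerP v : reflect (forall l, (l <= j)%N -> c i l v = 0) (v \in lker P).
  rewrite memv_ker PE; apply: (iffP eqP) => [v0 l lj|v0]; last first.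
    by rewrite big1 // => l _; rewrite v0 ?scale0r // -ltnS.
  have := congr1 (c i l) v0; rewrite linear0 linear_sum /=.
  rewrite (bigD1 (Ordinal (lj : (l < j.+1)%N))) //= linearZ /= c_g !eqxx.
  rewrite (leq_ltn_trans lj mj) big1 ?addr0 => [|l' ll']; last first.
    have {}ll' : (l == l' :> nat) = false by rewrite eq_sym; apply: negPf ll'.
    by rewrite linearZ /= c_g ll' andbF scaler0.
  by rewrite /GRing.scale /= mulr1.
have NP : Lat N (lker P).
  apply/LatP => v /kerP v0; apply/kerP => -[|l] lj; first exact: c_shift0.
  by rewrite c_shiftS ?v0 ?(leq_ltn_trans lj) // ltnW.
(* [S^-1] preserves dimension, and the codimension of [lker P] is the rank of [P], at most
   [j.+1 <= b]. *)
have dimP : (\dim {:V} <= \dim (S^-1 @: lker P)%VS + b)%N.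
  rewrite limg_dim_eq; last first.
    apply/eqP; rewrite -subv0; apply/subvP => v /memv_capP[_].
    rewrite memv_ker => /eqP Sv; rewrite memv0 -(lker0_lfunVK S0 v).
    by rewrite Sv linear0.
  rewrite -(limg_ker_dim P fullv) capfv leq_add2l.
  rewrite (leq_trans _ jb) //.
  pose s := [seq g i l | l <- iota 0 j.+1].
  rewrite (leq_trans (dimvS (_ : (_ <= <<s>>)%VS))) //.
    apply/subvP => _ /memv_imgP[v _ ->]; rewrite PE.
    apply: memv_suml => l _; apply: memvZ; apply: memv_span.
    by apply: map_f; rewrite mem_iota add0n ltn_ord.
  by rewrite (leq_trans (dim_span s)) // size_map size_iota.
have := iter_lfun_codim nilpotent_N ((NSV _).1 NP) dimP z.
move=> /(memv_img S); rewrite -limg_comp lker0_compfV // lim1g.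
by move/kerP; apply.
Qed.

(** Sending [g i l] to [N^l z] and the other blocks to 0 respects the only relation on the generator
    [g i 0], namely [N^(m i) (g i 0) = 0]. *)
Lemma commutant_extension i z : iter_lfun N (m i) z = 0 ->
  exists2 T, commutant N T &
    forall v, T v = \sum_(l < m i) (c i l v : K) *: iter_lfun N l z.
Proof.
move=> Nz; exists (\sum_(l < m i) rank1 (c i l) (iter_lfun N l z)); last first.
  by move=> v; rewrite sum_lfunE; apply: eq_bigr => l _; rewrite rank1E.
apply/commutantP => v; rewrite !sum_lfunE linear_sum.
under eq_bigr do rewrite rank1E.
under [RHS]eq_bigr do rewrite rank1E linearZ /= -iter_lfunS.
have c_shift l : (l.+1 < m i)%N -> c i l.+1 (N v) = c i l v.
  exact: c_shiftS.
case: (m i) Nz c_shift => [|p] Nz c_shift; first by rewrite !big_ord0.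
(* The left sum loses its first term, the right sum its last; the rest agrees after an index
   shift. *)
rewrite big_ord_recl big_ord_recr /= Nz scaler0 addr0 c_shift0 scale0r add0r.
by apply: eq_bigr => l _; rewrite c_shift // ltnS.
Qed.

(** The projection onto block [i] commutes with [N], so [M] contains the block [i] component of [v],
    and then every [g i l] from its first nonzero coordinate on. *)
Lemma hyperinvariant_g M i j v : LatOf (commutant N) M ->
  v \in M -> c i j v != 0 -> g i j \in M.
Proof.
move=> HM Mv cv.
have NM : Lat N M by apply: HM; apply/commutantP.
have : iter_lfun N (m i) (g i 0) = 0 by rewrite iter_lfun_g addn0 g_end.
case/commutant_extension=> P CP PE.
have Mw : P v \in M by move/LatP: (HM _ CP); apply.
have [j0 cj0 min_j0] := ex_minnP (ex_intro (fun l => c i l v != 0) j cv).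
have j0m : (j0 < m i)%N.
  by rewrite ltnNge; apply: contra cj0 => mj; rewrite c_end.
(* Descending induction on [l], with [d] bounding the distance to the end of the chain: [N^(l - j0)]
   turns the leading term of [P v] into a nonzero multiple of [g i l], and its other terms lie
   further along. *)
suff mem_g d l : (j0 <= l)%N -> (m i <= l + d)%N -> g i l \in M.
  by apply: (mem_g (m i)); [exact: min_j0 | exact: leq_addl].
elim: d l => [|d IHd] l jl ml; first by rewrite g_end ?mem0v // -(addn0 l).
have := Lat_iter (l - j0) NM Mw.
rewrite PE linear_sum (bigD1 (Ordinal j0m)) //= linearZ /= !iter_lfun_g addn0.
rewrite subnK // rpredDr => [|]; last first.
  apply: memv_suml => l' ne_l'; rewrite linearZ /= !iter_lfun_g addn0.
  have {}ne_l' : (l' : nat) != j0 by [].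
  have [l'j|j_l'|e] := ltngtP l' j0; last by rewrite e eqxx in ne_l'.
    suff -> : c i l' v = 0 by rewrite scale0r mem0v.
    by apply/eqP/negPn/negP => /min_j0; rewrite leqNgt l'j.
  by apply: memvZ; apply: IHd; lia.
by rewrite rpredZeq (negPf cj0).
Qed.

Lemma Col_sub_AlgLat : Col N `<=` invertibles (AlgOf (LatOf (commutant N))).
Proof.
suff sub S : Col N S -> AlgOf (LatOf (commutant N)) S.
  move=> S CS; have [/invertibles_lker0 S0 _] := CS.
  split; first exact: sub.
  exists (S^-1)%VF; split; first exact/sub/Col_inv.
    exact: lker0_compfV.
  exact: lker0_compVf.
move=> CS M HM; apply/LatP => v Mv.
rewrite (g_gen v) linear_sum; apply: memv_suml => i _.
rewrite linear_sum; apply: memv_suml => j _; rewrite linearZ /=.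
have [->|cv] := eqVneq (c i j v) 0; first by rewrite scale0r mem0v.
have Mg := hyperinvariant_g HM Mv cv.
have gE : g i j = iter_lfun N j (g i 0) by rewrite iter_lfun_g addn0.
have [y Sg] := Col_iter_img j (g i 0) CS; rewrite -gE in Sg.
(* [N^(m i - j)] kills [g i j], hence also its image [S (g i j) = N^j y]. *)
have Ny : iter_lfun N (m i) y = 0.
  rewrite -(subnK (ltnW (ltn_ord j))) iter_lfunD -Sg.
  apply: (Col_iter_ker nilpotent_N CS).
  by rewrite iter_lfun_g g_end // subnK // ltnW.
(* [T] maps [g i 0] to [y], so it agrees with [S] at [g i j]. *)
have [T CT TE] := commutant_extension Ny.
have <- : T (g i j) = S (g i j).
  rewrite TE Sg (bigD1 j) //= c_g !eqxx ltn_ord scale1r big1 ?addr0 // => l lj.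
  have {}lj : (l == j :> nat) = false by apply: negPf lj.
  by rewrite c_g lj andbF scale0r.
by apply: memvZ; move/LatP: (HM _ CT); apply.
Qed.

Lemma subgroup_Col :
  subgroup (Col N) (invertibles (AlgOf (LatOf (commutant N)))).
Proof.
split; [exact: Col_sub_AlgLat | exact: Col_id | |]; last exact: Col_inv.
exact: Col_comp.
Qed.

Lemma Col_neq_AlgLat a b : (2%:R : K) != 0 ->
  a != b -> (2 <= m a)%N -> (2 <= m b)%N ->
  Col N <> invertibles (AlgOf (LatOf (commutant N))).
Proof.
move=> K2 ab ma mb eqC.
pose p := (m a).-2; pose q := (m b).-2.
have pE : p.+2 = m a by rewrite /p; lia.
have qE : q.+2 = m b by rewrite /q; lia.
(* [S t] scales the last basis vector of block [a] by [1 + t]: [S 1] doubles it, and [t' = -1/2]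
   below gives the inverse. *)
pose S t : 'End(V) := (\1 + t *: rank1 (c a p.+1) (g a p.+1))%VF.
have SE t v : S t v = v + (t * c a p.+1 v) *: g a p.+1.
  by rewrite add_lfunE id_lfunE scale_lfunE rank1E scalerA.
have cc : c a p.+1 (g a p.+1) = 1 by rewrite c_g !eqxx -pE leqnn.
have S_alg t : AlgOf (LatOf (commutant N)) (S t).
  move=> M HM; apply/LatP => v Mv; rewrite SE.
  have [->|cv] := eqVneq (c a p.+1 v) 0.
    by rewrite mulr0 scale0r addr0.
  by rewrite rpredD // memvZ // (hyperinvariant_g HM Mv cv).
have cS t v : c a p.+1 (S t v) = c a p.+1 v + t * c a p.+1 v :> K.
  by rewrite SE linearD linearZ /= cc /GRing.scale /= mulr1.
have SK t t' : t + t' + t * t' = 0 -> (S t \o S t' = \1)%VF.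
  move=> tt'; apply/lfunP => v; rewrite comp_lfunE id_lfunE SE cS SE.
  rewrite -addrA -scalerDl mulrDr mulrA.
  by rewrite -!mulrDl addrA [t' + t]addrC tt' mul0r scale0r addr0.
pose t' : K := - 2%:R^-1.
have t'E : 1 + t' + 1 * t' = 0.
  by rewrite mul1r -addrA -mulr2n -mulr_natr mulNr mulVf // subrr.
have S1 : Col N (S 1).
  rewrite eqC; split=> //; exists (S t'); split=> //; apply: SK => //.
  by rewrite mulr1 mul1r in t'E *; rewrite [t' + 1]addrC.
have [_ NS] := S1.
pose x := g a p + g b q.
have Nx : N x = g a p.+1 + g b q.+1 by rewrite linearD /= !g_shift.
have NNx : N (N x) = 0 by rewrite Nx linearD /= !g_shift !g_end ?addr0 ?pE ?qE.
pose M := (<[x]> + <[N x]>)%VS.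
have Mx : x \in M by rewrite memvE addvSl.
have MNx : N x \in M by rewrite memvE addvSr.
have NM : Lat N M.
  apply/LatP => _ /memv_addP[_ /vlineP[s ->] [_ /vlineP[s' ->] ->]].
  by rewrite linearD !linearZ /= NNx scaler0 addr0 memvZ.
have ba : (b == a) = false by rewrite eq_sym; apply: negPf.
have nS n : (n.+1 == n) = false by rewrite eqn_leq ltnn.
have nSr n : (n == n.+1) = false by rewrite eq_sym nS.
have cD i j u v : c i j (u + v) = c i j u + c i j v by exact: linearD.
have cE := (cD, c_g, eqxx, negPf ab, ba, nS, nSr, andbF, addr0, add0r).
have cx : [/\ c a p x = 1, c a p.+1 x = 0 & c b q.+1 x = 0].
  by rewrite /x !cE -pE ltnS leqnSn.
have cNx : [/\ c a p (N x) = 0, c a p.+1 (N x) = 1 & c b q.+1 (N x) = 1].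
  by rewrite Nx !cE -pE -qE !leqnn.
have cSg : [/\ c a p (g a p.+1) = 0 & c b q.+1 (g a p.+1) = 0] by rewrite !cE.
have Sx : S 1 x = x.
  by rewrite SE; case: cx => _ -> _; rewrite mulr0 scale0r addr0.
(* [S 1] fixes [x], and the image of [M] is invariant because [S 1] is a collineation. *)
have : N x \in (S 1 @: M)%VS.
  by move/LatP: ((NS M).1 NM); apply; rewrite -{1}Sx memv_img.
case/memv_imgP => _ /memv_addP[_ /vlineP[s ->] [_ /vlineP[s' ->] ->]].
clearbody x; rewrite SE mul1r => NxE.
(* The last coordinates in blocks [b] and [a] give [1 = s'] and [1 = s' + s'], a contradiction. *)
have := (congr1 (c a p) NxE, congr1 (c a p.+1) NxE, congr1 (c b q.+1) NxE).
rewrite !(linearD, linearZ) /= cc.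
case: cx cNx cSg => -> -> -> [-> -> ->] [-> ->].
rewrite /GRing.scale /= !(mulr0, mulr1, add0r, addr0).
case=> -[_ e2] e1; rewrite -e1 in e2; move/eqP: e2.
by rewrite -[X in X == _]addr0 (inj_eq (addrI _)) eq_sym oner_eq0.
Qed.

Lemma Col_eq_AlgLat a : (forall i, i != a -> (m i <= 1)%N) ->
  Col N = invertibles (AlgOf (LatOf (commutant N))).
Proof.
move=> m1; apply/seteqP; split; first exact: Col_sub_AlgLat.
have hyperN M : Lat N M -> LatOf (commutant N) (N @: M)%VS.
  move=> NM T CT; apply/LatP => _ /memv_imgP[v Mv ->].
  have gN i j : i != a -> g i j.+1 = 0.
    by move=> ia; rewrite g_end // (leq_trans (m1 i ia)).
  (* The polynomial in [N] whose coefficients are the block [a] coordinates of [T (g a 0)]; [N]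
     kills the components of [T (g a 0)] in the other blocks. *)
  pose q := (\sum_(l < m a) (c a l (T (g a 0)) : K) *: iter_lfun N l)%R.
  suff TN : T (N v) = N (q v).
    rewrite TN memv_img // /q sum_lfunE; apply: memv_suml => l _.
    by rewrite scale_lfunE memvZ // Lat_iter.
  suff : (T \o N = N \o q)%VF by move=> /lfunP/(_ v); rewrite !comp_lfunE.
  apply: eqV_g => i j _; rewrite !comp_lfunE g_shift.
  have [->|ia] := eqVneq i a; last first.
    rewrite gN // linear0 sum_lfunE linear_sum big1 // => l _.
    by rewrite scale_lfunE linearZ /= iter_lfun_g g_shift gN // scaler0.
  rewrite -[j.+1]addn0 -iter_lfun_g commutant_iter // iter_lfunSr.
  rewrite {1}(g_gen (T (g a 0))) !linear_sum (bigD1 a) //= [X in _ + X]big1.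
    rewrite addr0 sum_lfunE !linear_sum; apply: eq_bigr => l _.
    rewrite scale_lfunE !linearZ /= g_shift !iter_lfun_g g_shift.
    by rewrite addnS addnC.
  move=> i' i'a; rewrite !linear_sum big1 // => l _.
  by rewrite !linearZ /= g_shift gN // linear0 scaler0.
have sub S T : AlgOf (LatOf (commutant N)) S -> AlgOf (LatOf (commutant N)) T ->
    (S \o T = \1)%VF -> forall M, Lat N M -> Lat N (S @: M)%VS.
  move=> HS HT ST M NM; have HL := hyperN M NM.
  have HL' : LatOf (commutant N) (N @^-1: (N @: M))%VS.
    move=> U CU; apply/LatP => v; rewrite -!memv_preim => Mv.
    by move/commutantP: (CU) => <-; move/LatP: (HL U CU); apply.
  have SL' : (S @: M <= N @^-1: (N @: M))%VS.
    apply: subv_trans (HS _ HL'); apply: limgS; apply/subvP => v Mv.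
    by rewrite -memv_preim memv_img.
  apply/LatP => v /(subvP SL'); rewrite -memv_preim => NMv.
  (* The inverse [T] also preserves [N M], so [N v = S (T (N v))] lies in [S (N M)], inside
     [S M]. *)
  have : T (N v) \in (N @: M)%VS by move/LatP: (HT _ HL); apply.
  move/(subvP NM)/(memv_img S).
  by rewrite -comp_lfunE ST id_lfunE.
move=> S [HS [T [HT ST TS]]]; split; first by split=> //; exists T.
move=> M; split; first exact: sub HS HT ST M.
by move/(sub _ _ HT HS TS); rewrite -limg_comp TS lim1g.
Qed.

End JordanBasis.

(** * The Jordan basis and its dual coordinates for the concrete block matrix *)

Section JordanMatrix.
Variables (K : fieldType) (k : nat) (m : 'I_k -> nat).

Local Notation V := 'cV[K]_(\sum_(i < k) m i).
Local Notation N := (jordan_nilpotent K m).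

(* The vector [j] places before the end of block [i], so that the action of the
   nilpotent on block [i] raises the index [j]; it is 0 when [m i <= j]. *)
Definition jordan_vec (i : 'I_k) (j : nat) : V :=
  \mxcol_i' \col_(l < m i') ((i' == i) && (l + j.+1 == m i')%N)%:R.

(** The entry of block [i] in row [m i - j.+1]; the sum form gives 0 when [m i <= j]. *)
Definition jordan_coord_fun (i : 'I_k) (j : nat) (v : V) : K^o :=
  \sum_(l < m i) (l + j.+1 == m i)%N%:R * submxcol v i l 0.

Fact jordan_coord_fun_is_linear i j : linear (jordan_coord_fun i j).
Proof.
move=> a u v; rewrite /jordan_coord_fun scaler_sumr -big_split /=.
apply: eq_bigr => l _.
by rewrite !mxE mulrDr; congr (_ + _); rewrite /GRing.scale /= mulrCA.
Qed.

HB.instance Definition _ i j :=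
  GRing.isLinear.Build K V K^o *:%R (jordan_coord_fun i j)
    (jordan_coord_fun_is_linear i j).

Definition jordan_coord i j : 'Hom(V, K^o) := linfun (jordan_coord_fun i j).

Lemma jordan_coordE i j (v : V) (l : 'I_(m i)) :
  (l + j.+1 = m i)%N -> jordan_coord i j v = submxcol v i l 0.
Proof.
move=> lj; rewrite lfunE /= /jordan_coord_fun (bigD1 l) //= lj eqxx mul1r.
rewrite big1 ?addr0 // => l' ne_l'; case: eqP => [l'j|_]; last by rewrite mul0r.
by case/eqP: ne_l'; apply/val_inj/eqP; rewrite -(eqn_add2r j.+1) l'j lj.
Qed.

Lemma jordan_coord_end i j (v : V) : (m i <= j)%N -> jordan_coord i j v = 0.
Proof.
move=> mj; rewrite lfunE /= /jordan_coord_fun big1 // => l _.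
case: eqP => [lj|_]; last by rewrite mul0r.
by have := ltn_ord l; lia.
Qed.

Lemma jordan_vec_end i j : (m i <= j)%N -> jordan_vec i j = 0.
Proof.
move=> mj; apply/mxcolP => i'; rewrite mxcolK submxcol0.
apply/colP => l; rewrite !mxE; case: eqP => //= i'i; rewrite -i'i in mj.
by case: eqP => // lj; have := ltn_ord l; lia.
Qed.

Lemma jordan_nilpotent_vec i j : N (jordan_vec i j) = jordan_vec i j.+1.
Proof.
rewrite lfunE /= mul_mxdiag_mxcol; apply: eq_mxcol => i'; apply/colP => l.
(* Row [l] of a Jordan block has its only 1 in column [l.+1]; the last row is zero. *)
rewrite !mxE; case: (ltnP l.+1 (m i')) => lm.
  rewrite (bigD1 (Ordinal lm)) //= big1 => [|l' ne_l'].
    by rewrite !mxE /= eqxx mul1r addr0 addSnnS.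
  rewrite !mxE; case: eqP => [e|_]; last by rewrite mul0r.
  by case/eqP: ne_l'; apply/val_inj.
rewrite big1 => [|l' _].
  by have := ltn_ord l; case: eqP => //= _; case: eqP => //; lia.
rewrite !mxE; case: eqP => [e|_]; last by rewrite mul0r.
by have := ltn_ord l'; rewrite -e ltnNge lm.
Qed.

Lemma jordan_coord_vec i j i' j' :
  jordan_coord i j (jordan_vec i' j') =
    [&& i == i', j == j' & (j < m i)%N]%:R.
Proof.
case: (ltnP j (m i)) => [jm|mj]; last by rewrite jordan_coord_end // !andbF.
have lm : (m i - j.+1 < m i)%N by lia.
rewrite (@jordan_coordE _ _ _ (Ordinal lm)) /=; last by lia.
rewrite mxcolK mxE /= andbT; congr (_ && _)%:R.
by apply/eqP/eqP; lia.
Qed.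

Lemma jordan_vec_gen v :
  v = \sum_i \sum_(j < m i) (jordan_coord i j v : K) *: jordan_vec i j.
Proof.
have entry i' j' (t : K) i l : submxcol (t *: jordan_vec i' j') i l 0 =
    t * ((i == i') && (l + j'.+1 == m i)%N)%:R.
  have -> : submxcol (t *: jordan_vec i' j') i =
      t *: submxcol (jordan_vec i' j') i.
    by apply/matrixP => r s; rewrite !mxE.
  by rewrite mxcolK !mxE.
apply/mxcolP => i; apply/colP => l; rewrite submxcol_sum summxE.
rewrite (bigD1 i) //= [X in _ + X]big1 ?addr0 => [|i' ne_i]; last first.
  rewrite submxcol_sum summxE big1 // => j _.
  by rewrite entry eq_sym (negPf ne_i) mulr0.
have jm : (m i - l.+1 < m i)%N by have := ltn_ord l; lia.
rewrite submxcol_sum summxE (bigD1 (Ordinal jm)) //=.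
rewrite [X in _ + X]big1 => [|j ne_j].
  have lm : (l + (m i - l.+1).+1 = m i)%N by have := ltn_ord l; lia.
  by rewrite entry eqxx lm eqxx mulr1 addr0 (jordan_coordE _ lm).
rewrite entry eqxx /=; case: eqP => [e|_]; last by rewrite mulr0.
by case/eqP: ne_j; apply/val_inj => /=; lia.
Qed.

End JordanMatrix.

Theorem theorem7 (R : realType) (k : nat) (m : 'I_k -> nat)
    (k_gt0 : (0 < k)%N) (m_gt0 : forall i : 'I_k, (0 < m i)%N) :
  let N := jordan_nilpotent (complex R) m in
  proper_subgroup (Col N) (invertibles (AlgOf (LatOf (commutant N))))
  <-> (2 <= #|[pred i : 'I_k | (2 <= m i)%N]|)%N.
Proof.
move=> N.
have gS := @jordan_nilpotent_vec (complex R) k m.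
have ge := @jordan_vec_end (complex R) k m.
have cg := @jordan_coord_vec (complex R) k m.
have gg := @jordan_vec_gen (complex R) k m.
split=> [[_ neq]|/card_gt1P[a [b [ma mb ab]]]]; last first.
  split; first exact: (subgroup_Col gS ge cg gg).
  apply: (Col_neq_AlgLat gS ge cg gg _ ab ma mb).
  by rewrite Num.Theory.pnatr_eq0.
apply: contra_notT neq; rewrite -leqNgt => card1.
have [a m1] : exists a, forall i, i != a -> (m i <= 1)%N.
  case: (pickP [pred i : 'I_k | (2 <= m i)%N]) => [a ma | m1].
    exists a => i ia; rewrite leqNgt; apply/negP => mi.
    by move: card1; rewrite leqNgt => /card_gt1P[]; exists i, a.
  (* If every block has size 1, any index serves as [a]. *)
  by exists (Ordinal k_gt0) => i _; rewrite leqNgt; apply/negbT/m1.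
exact: (Col_eq_AlgLat gS ge cg gg m1).
Qed.
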